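(* For every integer $t \geq 4$, $$R_t(3) \geq 169 \cdot 3^{t-4}+1.$$ For every integer $t \geq 2$, $$R_t(6) \geq 829 \cdot 27^{t-2} +1 \qquad \text{and} \qquad R_t(8) \geq 3320 \cdot 56^{t-2} +1.$$
   Context: A tournament is a digraph in which every pair of distinct vertices is joined by exactly one oriented edge (and there are no loops). A tournament is transitive if, whenever $a \to b$ and $b \to c$, then $a \to c$. For positive integers $t, m$, the (multicolor directed) Ramsey number $R_t(m)$ is the least positive integer $n$ such that any tournament with $n$ vertices, whose edges have been colored in $t$ colors, contains a monochromatic transitive subtournament of order $m$ (i.e. a transitive subtournament on $m$ vertices all of whose edges have the same color). *)

(* Defs.v *)
From mathcomp Require Import all_boot.

Set Implicit Arguments.
Unset Strict Implicit.
Unset Printing Implicit Defensive.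

(* A digraph on T is given by its set of arcs E : {set T * T}; (x, y) \in E
   means x -> y. *)
Definition tournament (T : finType) (E : {set T * T}) : bool :=
  [forall x, (x, x) \notin E] &&
  [forall x, forall y, (x != y) ==> (((x, y) \in E) (+) ((y, x) \in E))].

Definition transitive_on (T : finType) (E : {set T * T}) (A : {set T}) : bool :=
  [forall a in A, forall b in A, forall c in A,
     ((a, b) \in E) ==> ((b, c) \in E) ==> ((a, c) \in E)].

(* A colouring of the arcs is a function on all ordered pairs; only its values
   on E are ever used. *)
Definition monochromatic_on (T : finType) (t : nat) (E : {set T * T})
    (col : {ffun T * T -> 'I_t}) (A : {set T}) : bool :=
  [exists k : 'I_t, forall x in A, forall y in A,
     ((x, y) \in E) ==> (col (x, y) == k)].

(* Every n-vertex tournament is isomorphic to one on 'I_n, so it suffices to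
   quantify over arc sets on 'I_n. *)
Definition ramsey_property (t m n : nat) : bool :=
  [forall E : {set 'I_n * 'I_n}, forall col : {ffun 'I_n * 'I_n -> 'I_t},
     tournament E ==>
     [exists A : {set 'I_n},
        [&& #|A| == m, transitive_on E A & monochromatic_on E col A]]].

Section Existence.

Variables (T : finType) (t : nat) (E : {set T * T}).
Variable col : {ffun T * T -> 'I_t}.
Hypothesis tourE : tournament E.

Let mono k (A : {set T}) :=
  forall x y, x \in A -> y \in A -> (x, y) \in E -> col (x, y) = k.

Let trans (A : {set T}) := forall x y z, x \in A -> y \in A -> z \in A ->
  (x, y) \in E -> (y, z) \in E -> (x, z) \in E.

Let arc x (p : bool * 'I_t) y :=
  if p.1 then ((x, y) \in E) && (col (x, y) == p.2)
  else ((y, x) \in E) && (col (y, x) == p.2).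

Let loopless x : (x, x) \in E = false.
Proof. by case/andP: tourE => /forallP/(_ x)/negbTE. Qed.

Let asym x y : (x, y) \in E -> (y, x) \in E -> False.
Proof.
move=> xy yx; case/andP: tourE => _ /forallP/(_ x)/forallP/(_ y).
by case: eqVneq xy yx => [->|_ -> ->] //; rewrite loopless.
Qed.

Let total x y : x != y -> ((x, y) \in E) || ((y, x) \in E).
Proof.
move=> xy; case/andP: tourE => _ /forallP/(_ x)/forallP/(_ y).
by rewrite xy /=; case: ((x, y) \in E).
Qed.

Let extend x (p : bool * 'I_t) (A : {set T}) :
  {in A, forall y, arc x p y} -> mono p.2 A -> trans A ->
  mono p.2 (x |: A) /\ trans (x |: A).
Proof.
case: p => d k /= arcA monoA transA; split.
- move=> y z; rewrite !inE => /predU1P[->|yA] /predU1P[->|zA].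
  + by rewrite loopless.
  + by move: (arcA _ zA); rewrite /arc; case: d {arcA} =>
      /andP[e /eqP ck] e' //; case: (asym e e').
  + by move: (arcA _ yA); rewrite /arc; case: d {arcA} =>
      /andP[e /eqP ck] e' //; case: (asym e e').
  + exact: monoA.
- move=> a b c; rewrite !inE => /predU1P[->|aA] /predU1P[->|bA] /predU1P[->|cA];
    rewrite ?loopless //.
  + by move=> e1 e2; case: (asym e1 e2).
  + move=> e1 _; move: (arcA _ cA) (arcA _ bA).
    by rewrite /arc; case: d {arcA} => /andP[e2 _] /andP[e3 _] //;
      case: (asym e1 e3).
  + move=> e1 e2; move: (arcA _ aA) (arcA _ cA).
    by rewrite /arc; case: d {arcA} => /andP[e3 _] /andP[e4 _];
      [case: (asym e1 e3) | case: (asym e2 e4)].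
  + move=> e1 e2; move: (arcA _ aA) (arcA _ bA).
    by rewrite /arc; case: d {arcA} => /andP[e3 _] /andP[e4 _] //;
      case: (asym e2 e4).
  + exact: transA.
Qed.

Let class x y : bool * 'I_t :=
  if (x, y) \in E then (true, col (x, y)) else (false, col (y, x)).

Let arc_class x y : x != y -> arc x (class x y) y.
Proof.
move=> xy; move: (total xy); rewrite /arc /class.
by case: ((x, y) \in E) => /= [_|->]; rewrite eqxx.
Qed.

Let large_class (V : {set T}) x N : x \in V -> 0 < N ->
  t.*2.+1 * N <= #|V| ->
  exists p, N <= #|[set y in V :\ x | class x y == p]|.
Proof.
move=> xV N0; rewrite (cardsD1 x) xV add1n mulSn => hV.
apply/existsP; apply: contraLR hV.
rewrite negb_exists -ltnNge => /forallP small.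
have -> : #|V :\ x| = \sum_p #|[set y in V :\ x | class x y == p]|.
  rewrite -sum1_card (partition_big (class x) xpredT) //=.
  by apply: eq_bigr => p _; rewrite -sum1_card; apply: eq_bigl => y; rewrite !inE.
have : \sum_p #|[set y in V :\ x | class x y == p]| <= \sum_(p : bool * 'I_t) N.-1.
  apply: leq_sum => p _; move: (small p).
  by rewrite -ltnNge => h; rewrite -ltnS prednK.
rewrite sum_nat_const card_prod card_bool card_ord mul2n => h.
rewrite -[N in N + _]prednK // addSn ltnS.
apply: leq_trans (leq_addl _ _).
have t0 : 0 < t.*2 by rewrite double_gt0; case: (t) (col (x, x)) => [[]|].
by apply: leq_ltn_trans h _; rewrite ltn_pmul2l // prednK.
Qed.

Lemma ramsey_sets s (V : {set T}) (f : 'I_t -> nat) :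
  \sum_k f k = s -> t.*2.+1 ^ s <= #|V| ->
  exists k (A : {set T}), [/\ A \subset V, #|A| = f k, mono k A & trans A].
Proof.
have empty k : f k = 0 ->
  exists k (A : {set T}), [/\ A \subset V, #|A| = f k, mono k A & trans A].
  by move=> f0; exists k, set0; rewrite sub0set cards0 f0; split=> // x y; rewrite inE.
elim: s V f empty => [|s IHs] V f empty fs hV.
  have /set0Pn[x _] : V != set0 by rewrite -card_gt0 (leq_trans _ hV).
  apply: (empty (col (x, x))); apply/eqP; move/eqP: fs.
  by rewrite sum_nat_eq0 => /forallP/(_ (col (x, x))).
have /set0Pn[x xV] : V != set0.
  by rewrite -card_gt0 (leq_trans _ hV) // expn_gt0.
rewrite expnS in hV; have [|p hp] := large_class xV _ hV; first by rewrite expn_gt0.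
case: (posnP (f p.2)) => [/empty //|fp].
pose W := [set y in V :\ x | class x y == p].
have WV : W \subset V by apply/subsetP => y; rewrite !inE => /andP[/andP[]].
pose g k := f k - (k == p.2).
have gs : \sum_k g k = s.
  apply: succn_inj; rewrite -fs (bigD1 p.2) // [in RHS](bigD1 p.2) //= {1}/g eqxx.
  rewrite -addSn subn1 prednK //; congr (_ + _).
  by apply: eq_bigr => k /negbTE kp; rewrite /g kp subn0.
have [|k [A [AW cA mA tA]]] := IHs W g _ gs hp.
  by move=> k g0; exists k, set0; rewrite sub0set cards0 g0; split=> // y z; rewrite inE.
have AV := subset_trans AW WV.
case: (eqVneq k p.2) => [kp|kp]; last first.
  by exists k, A; split=> //; rewrite cA /g (negbTE kp) subn0.
have arcA : {in A, forall y, arc x p y}.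
  move=> y /(subsetP AW); rewrite !inE => /andP[/andP[yx _] /eqP <-].
  by apply: arc_class; rewrite eq_sym.
have [mxA txA] : mono k (x |: A) /\ trans (x |: A).
  by rewrite kp in mA *; apply: extend.
exists k, (x |: A); split=> //; first by rewrite subUset sub1set xV.
have xA : x \notin A by apply/negP => /(subsetP AW); rewrite !inE eqxx.
by rewrite cardsU1 xA cA /g kp eqxx subn1 add1n prednK.
Qed.

End Existence.

(* Needed for ramsey below to be a total function. *)
Lemma ramsey_exists (t m : nat) : exists n, (0 < n) && ramsey_property t m n.
Proof.
exists (t.*2.+1 ^ (t * m)); rewrite expn_gt0 /=.
apply/forallP => E; apply/forallP => col; apply/implyP => tourE.
have [||k [A [_ cA mA tA]]] :=
  @ramsey_sets _ _ E col tourE (t * m) setT (fun _ => m).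
- by rewrite sum_nat_const card_ord.
- by rewrite cardsT card_ord.
apply/existsP; exists A; rewrite cA eqxx /=; apply/andP; split.
  apply/forall_inP => a aA; apply/forall_inP => b bA; apply/forall_inP => c cA'.
  by apply/implyP => ab; apply/implyP; apply: tA.
apply/existsP; exists k; apply/forall_inP => a aA; apply/forall_inP => b bA.
by apply/implyP => ab; rewrite (mA a b).
Qed.

Definition ramsey (t m : nat) : nat := ex_minn (ramsey_exists t m).

(* Main.v *)
Require Import Defs.
From Stdlib Require NArith.
From HB Require Import structures.
From mathcomp Require Import all_boot all_algebra cyclic finfield ring zify.

Set Implicit Arguments.
Unset Strict Implicit.
Unset Printing Implicit Defensive.

Import GRing.Theory.

(** All the lower bounds come from explicit colourings.  Orienting and
    t-colouring the pairs of an n-set is the same as giving every ordered pair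
    of distinct points a signed colour, reversed when the pair is reversed; a
    monochromatic transitive subtournament, listed from its source to its sink,
    is then a chain: a sequence in which every earlier-later pair has one and
    the same signed colour.  So R_t(m) > n as soon as some signed colouring of
    n points has no chain of length m ([avoidable], [ramsey_gt]).

    Substituting one colouring into all the points of another, on disjoint
    palettes, multiplies the numbers of points and keeps chains short
    ([avoidable_mul]).  With a one-colour factor this yields the geometric
    growth in t, with ratios 3, 27 and 56, and 169 is 13 * 13.  It remains to
    treat three values of m with one and two colours: 3 and 13 points for
    m = 3, 27 and 829 points for m = 6, 56 and 3320 points for m = 8.

    Power residues.  Let F be a field with q = 2te + 1 elements, e odd.  Then
    x^e is a 2t-th root of unity for x <> 0, and (-x)^e = - x^e, so (y - x)^e
    is a signed colour of the pair (x, y) ([signed_colours],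
    [avoidable_residues]).  An affine map brings any chain to the form
    0, 1, x_3, x_4, ..., all differences having e-th power 1; the x_i lie in
    the small set of x with x^e = (x - 1)^e = 1 ([residue_chain_normalization]),
    and an exhaustive search there bounds all chains.  The fields of order 3,
    13, 27 and 829, with t = 1, 2, 1, 2, give the values for m = 3 and m = 6.

    Double covers.  To pass from 6 to 8, take as points the nonzero vectors of
    F^2 up to multiplication by 2t-th powers; there are 2t(q + 1) of them, that
    is 56 for q = 27 and 3320 for q = 829.  Colour (u, v) by det(u, v)^e, and
    pairs on a common line through 0 arbitrarily.  Multiplying a vector by a
    scalar multiplies its colours to all other lines by a constant, so in a
    long chain the only two points that can share a line are the first and the
    last, which are opposite.  In an affine chart of the projective line that
    sends the line of the first point to infinity, the points of the chain on
    other lines form a chain of the power residue colouring.  Hence chains are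
    longer than those in F by at most two points ([avoidable_double_cover]). *)

(** * Signed colourings without long chains *)

Definition flip t (k : bool * 'I_t) := (~~ k.1, k.2).

(** The colour (true, k) of (x, y) stands for an arc x -> y of colour k, and
    (false, k) for an arc y -> x of colour k.  Reversal
    exchanges the chains of colours (true, k) and (false, k); quantifying over
    both lets a construction permute signed colours freely. *)
Definition avoidable t m n := exists (T : finType) (c : T -> T -> bool * 'I_t),
  [/\ #|T| = n,
      forall x y, x != y -> c y x = flip (c x y)
    & forall k s, pairwise (fun x y => (x != y) && (c x y == k)) s ->
        size s < m].

Section Transitive.

Variables (T : finType) (E : {set T * T}).
Hypothesis tourE : tournament E.

(** On A the reflexive closure of E is a total order, and sorting by it lists
    A from its source to its sink. *)
Lemma transitive_pairwise (A : {set T}) : transitive_on E A ->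
  exists2 s, perm_eq s (enum A) & pairwise (fun x y => (x, y) \in E) s.
Proof.
move=> /forall_inP tA.
have trE a b c : a \in A -> b \in A -> c \in A ->
    (a, b) \in E -> (b, c) \in E -> (a, c) \in E.
  move=> aA bA cA ab bc.
  move/forall_inP/(_ b bA)/forall_inP/(_ c cA): (tA a aA).
  by rewrite ab bc.
case/andP: tourE => _ /forallP tot.
have totE x y : x != y -> ((x, y) \in E) (+) ((y, x) \in E).
  by move=> xy; move/forallP/(_ y): (tot x); rewrite xy.
pose r := [rel x y | (x == y) || ((x, y) \in E)].
have sA x : x \in sort r (enum A) -> x \in A by rewrite mem_sort mem_enum.
have srt : sorted r (sort r (enum A)).
  apply: (@sort_sorted_in _ [in A] r) => [x y _ _ /=|].
    rewrite eq_sym; case: eqVneq => //= yx; move: (totE _ _ yx).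
    by rewrite orbC; case: ((y, x) \in E).
  by apply/allP => x; rewrite mem_enum.
exists (sort r (enum A)); first by rewrite perm_sort.
have pw : pairwise r (sort r (enum A)).
  rewrite -(@sorted_pairwise_in _ [in A] r) //.
    move=> b a c bA aA cA /= /predU1P[->//|ab] /predU1P[<-|bc].
      by rewrite ab orbT.
    by rewrite (trE a b c) ?orbT.
  by apply/allP => x /sA.
have : uniq (sort r (enum A)) by rewrite sort_uniq enum_uniq.
rewrite uniq_pairwise => up.
have : pairwise [rel x y | r x y && (x != y)] (sort r (enum A)).
  by rewrite pairwise_relI pw.
by apply: sub_pairwise => x y /=; case: eqVneq; rewrite ?andbF ?andbT.
Qed.

End Transitive.

Lemma pairwise_total (T : eqType) (r : rel T) s x y :
  pairwise r s -> x \in s -> y \in s -> x != y -> r x y || r y x.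
Proof.
elim: s => //= a s IHs /andP[/allP ra ps].
rewrite !inE => /predU1P[->|xs] /predU1P[->|ys]; first by rewrite eqxx.
- by rewrite ra.
- by rewrite ra ?orbT.
- exact: IHs.
Qed.

(** If the Ramsey number n' were at most n, the restriction of the colouring
    to n' of its points would be a counterexample to its defining property. *)
Lemma ramsey_gt t m n : avoidable t m n -> n + 1 <= ramsey t m.
Proof.
move=> [T [c [cT anti short]]]; rewrite addn1 /ramsey.
case: ex_minnP => n' /andP[_ /forallP ram] _; rewrite ltnNge -cT.
apply/negP => n'T; pose h (i : 'I_n') := enum_val (widen_ord n'T i).
have h_inj : injective h.
  by move=> i j /enum_val_inj/(congr1 (@nat_of_ord _))/= /ord_inj.
pose E := [set p : 'I_n' * 'I_n' | (p.1 != p.2) && (c (h p.1) (h p.2)).1].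
pose col := [ffun p : 'I_n' * 'I_n' => (c (h p.1) (h p.2)).2].
have tourE : tournament E.
  apply/andP; split; apply/forallP => x; first by rewrite !inE eqxx.
  apply/forallP => y; apply/implyP => xy; rewrite !inE /= xy eq_sym xy /=.
  by rewrite (anti (h x)) ?(inj_eq h_inj) //=; case: (c _ _).1.
move/forallP/(_ col): (ram E); rewrite tourE /=.
case/existsP=> A /and3P[/eqP cA trA /existsP[k /forall_inP monoA]].
have [s sA ps] := transitive_pairwise tourE trA.
have : size (map h s) < m.
  apply: (short (true, k)); rewrite pairwise_map.
  apply: (@sub_in_pairwise _ [in A]) ps; last first.
    by apply/allP => x; rewrite (perm_mem sA) mem_enum.
  move=> x y xA yA /= xyE.
  move/forall_inP/(_ y yA)/implyP/(_ xyE): (monoA x xA); rewrite ffunE /=.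
  move: xyE; rewrite !inE /= (inj_eq h_inj) => /andP[-> ] /=.
  by case: (c _ _) => -[] //= j _ /eqP->.
by rewrite size_map (perm_size sA) -cardE cA ltnn.
Qed.

(** Lexicographic product.  A chain in a colour of the first palette moves the
    first coordinate at each step, so it projects to a chain of the first
    factor; in a colour of the second palette that coordinate is constant. *)
Lemma avoidable_mul t1 t2 m n1 n2 :
  avoidable t1 m n1 -> avoidable t2 m n2 -> avoidable (t1 + t2) m (n1 * n2).
Proof.
move=> [T1 [c1 [cT1 anti1 short1]]] [T2 [c2 [cT2 anti2 short2]]].
pose c (x y : T1 * T2) : bool * 'I_(t1 + t2) :=
  if x.1 != y.1 then ((c1 x.1 y.1).1, lshift t2 (c1 x.1 y.1).2)
  else ((c2 x.2 y.2).1, rshift t1 (c2 x.2 y.2).2).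
exists (T1 * T2)%type, c; split; first by rewrite card_prod cT1 cT2.
  move=> [x1 x2] [y1 y2]; rewrite xpair_eqE negb_and /c /= eq_sym.
  case: (eqVneq y1 x1) => [|yx] /= => [_ /anti2->|_] //.
  by rewrite anti1 // eq_sym.
move=> [b k] s; case: (split_ordP k) => j ->{k} ps.
  have := short1 (b, j) (map fst s); rewrite size_map pairwise_map; apply.
  apply: sub_pairwise ps => x y /= /andP[_]; rewrite /c.
  case: ifP => [xy|_] /=.
    by case: (c1 _ _) => b1 k1; rewrite !xpair_eqE eq_lshift.
  by rewrite !xpair_eqE eq_rlshift andbF.
have := short2 (b, j) (map snd s); rewrite size_map pairwise_map; apply.
apply: sub_pairwise ps => -[x1 x2] [y1 y2] /=; rewrite /c xpair_eqE /=.
case: ifP => [_|/negbFE->] /=; first by rewrite !xpair_eqE eq_lrshift !andbF.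
by case: (c2 _ _) => b2 k2; rewrite !xpair_eqE eq_rshift.
Qed.

Lemma avoidable_iter t m n n1 j :
  avoidable 1 m n1 -> avoidable t m n -> avoidable (j + t) m (n * n1 ^ j).
Proof.
move=> a1 a; elim: j => [|j IHj]; first by rewrite muln1.
by rewrite expnS mulnCA; apply: (avoidable_mul a1 IHj).
Qed.

(** * Power residue colourings of finite fields *)

Section PowerResidues.

Local Open Scope ring_scope.

Variables (F : finFieldType) (t e : nat).
Hypothesis cardF : (#|F| = t.*2 * e + 1)%N.
Hypothesis odd_e : odd e.

Definition residue_arc (z : F) : rel F :=
  fun x y => (x != y) && ((y - x) ^+ e == z).

Let t_gt0 : (0 < t)%N.
Proof. by case: t cardF (finNzRing_gt1 F) => // ->. Qed.

Let e_gt0 : (0 < e)%N. Proof. by case: e odd_e. Qed.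

(** The 2t-th roots of unity, with z |-> -z, are a copy of the signed colours.
    Since zeta^t = -1, writing z = zeta^i with i < 2t, the sign of z is decided
    by i < t and its colour is i modulo t. *)
Lemma signed_colours : exists (f : F -> bool * 'I_t) (zeta : F),
  [/\ (t.*2).-primitive_root zeta,
      {in [pred z | z ^+ t.*2 == 1] &, injective f}
    & {in [pred z | z ^+ t.*2 == 1], forall z, f (- z) = flip (f z)}].
Proof.
have n0 : (0 < t.*2 * e)%N by rewrite muln_gt0 double_gt0 t_gt0.
pose rs := rem (0 : F) (enum F).
have /hasP[g _ prim_g] : has (t.*2 * e).-primitive_root rs.
  apply: has_prim_root n0 _ _ _.
  - apply/allP => x; rewrite mem_rem_uniq ?enum_uniq // inE /= => /andP[x0 _].
    apply/unity_rootP; have := expf_card x; rewrite cardF addn1 exprS.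
    by rewrite -[RHS]mulr1 => /(mulfI x0).
  - by rewrite rem_uniq ?enum_uniq.
  - by rewrite size_rem ?mem_enum // -cardE cardF addn1.
have [z prim_z] : exists z : F, (t.*2).-primitive_root z.
  by eexists; apply: (dvdn_prim_root prim_g); apply: dvdn_mulr.
have zt : z ^+ t = -1.
  have : (z ^+ t) ^+ 2 == 1 by rewrite -exprM muln2 prim_expr_order.
  rewrite sqrf_eq1 => /orP[|/eqP//]; rewrite -(prim_order_dvd prim_z).
  move/dvdn_leq => /(_ t_gt0).
  by rewrite -addnn -{3}[t]addn0 leq_add2l leqNgt t_gt0.
pose lg (x : F) := find (fun i => x == z ^+ i) (iota 0 t.*2).
have lgX i : (i < t.*2)%N -> lg (z ^+ i) = i.
  move=> ilt; rewrite /lg -[RHS](@index_uniq _ 0%N _ (iota 0 t.*2));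
    rewrite ?size_iota ?iota_uniq // nth_iota // add0n /index.
  apply: eq_in_find => j; rewrite mem_iota => jlt.
  by rewrite (eq_prim_root_expr prim_z) !modn_small // eq_sym.
have mod_lt x : (x %% t < t)%N by rewrite ltn_mod.
exists (fun x => ((lg x < t)%N, Ordinal (mod_lt (lg x)))), z.
split=> // [x y | x]; rewrite !inE.
  move=> /eqP/(prim_rootP prim_z)[[i it /= ->]].
  move=> /eqP/(prim_rootP prim_z)[[j jt /= ->]].
  have modE k : (k < t.*2)%N -> k = (k %% t + (t <= k) * t)%N.
    rewrite -addnn; case: (leqP t k) => tk k2; last first.
      by rewrite modn_small // addn0.
    by rewrite -{2}(subnK tk) modnDr mul1n modn_small ?subnK // ltn_subLR.
  rewrite !lgX // => -[lt_ij mod_ij].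
  congr (z ^+ _); rewrite (modE i) // (modE j) // mod_ij.
  by rewrite [(t <= i)%N]leqNgt lt_ij -leqNgt.
move=> /eqP/(prim_rootP prim_z)[[i it /= ->]].
have -> : - z ^+ i = z ^+ (if (i < t)%N then i + t else i - t)%N.
  case: ltnP => it'; first by rewrite exprD zt mulrN1.
  by rewrite -{1}(subnK it') exprD zt mulrN1 opprK.
rewrite !lgX //; last by move: it; rewrite -addnn; case: (ltnP i t); lia.
rewrite /flip /=; congr pair.
  by move: it; rewrite -addnn; case: (ltnP i t); lia.
apply: val_inj => /=; case: ltnP => it'; first by rewrite modnDr.
by rewrite -{2}(subnK it') modnDr.
Qed.

Lemma residue_colour_unity (x : F) : x != 0 -> (x ^+ e) ^+ t.*2 = 1.
Proof.
move=> x0; have := expf_card x; rewrite cardF addn1 exprS.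
by rewrite -[RHS]mulr1 => /(mulfI x0); rewrite mulnC exprM.
Qed.

Lemma avoidable_residues m :
  (forall z s, pairwise (residue_arc z) s -> (size s < m)%N) ->
  avoidable t m (t.*2 * e + 1).
Proof.
have [f [_ [_ f_inj fN]]] := signed_colours => short.
have unity (x y : F) : x != y -> (y - x) ^+ e \in [pred z | z ^+ t.*2 == 1].
  by move=> xy; rewrite inE residue_colour_unity // subr_eq0 eq_sym.
exists F, (fun x y => f ((y - x) ^+ e)); split=> // [x y xy|k [|x [|y s]] ps].
- by rewrite -fN ?unity // -opprB exprNn -signr_odd odd_e mulN1r.
- exact: (short 0 [::]).
- exact: (short 0 [:: x]).
have /= /andP[/andP[/andP[xy /eqP fxy] _] _] := ps.
apply: (short ((y - x) ^+ e) [:: x, y & s]).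
apply: sub_pairwise ps => a b /= /andP[ab /eqP fab].
by rewrite /residue_arc ab; apply/eqP/f_inj; rewrite ?unity // fab fxy.
Qed.

(** The determinant of the vectors (1, x), for Some x, and (0, 1), for None,
    which represent the points of the projective line. *)
Definition det (p q : option F) : F :=
  match p, q with
  | Some x, Some y => y - x
  | Some _, None => 1
  | None, Some _ => -1
  | None, None => 0
  end.

(** An affine coordinate on the projective line minus p; the value at p itself
    is a dummy. *)
Definition chart (p q : option F) : F :=
  match p, q with
  | Some x, Some y => - (y - x)^-1
  | None, Some y => y
  | _, None => 0
  end.

Lemma detN p q : det q p = - det p q.
Proof. by case: p q => [x|] [y|] /=; rewrite ?opprB ?opprK ?oppr0. Qed.

Lemma det_eq0 p q : (det p q == 0) = (p == q).
Proof.
case: p q => [x|] [y|] /=; rewrite ?oppr_eq0 ?oner_eq0 ?eqxx //.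
by rewrite subr_eq0 eq_sym.
Qed.

(** The chart at p differs from the standard coordinate by a Moebius map, and
    this is how such a map changes differences.  The factors det p q and
    det p r are those that the colours of (p, q) and (p, r) control. *)
Lemma chart_det p q r : p != q -> p != r ->
  (chart p r - chart p q) * (det p q * det p r) = det q r.
Proof.
rewrite -!det_eq0.
case: p q r => [x|] [y|] [z|] //= pq pr; rewrite ?eqxx // in pq pr *.
- by field; rewrite pq pr.
- by field.
- by field.
- by ring.
- by ring.
Qed.

(** The point (p, i) is the vector representing p, scaled by g^i where g^e is
    the root of unity zeta; powers of g run over the scalars modulo 2t-th
    powers.  The hypothesis 2t < m + 2 ensures that a chain of length m + 2
    leaves the line of its first point. *)
Lemma avoidable_double_cover m : (t.*2 < m.+2)%N ->
  (forall z s, pairwise (residue_arc z) s -> (size s < m)%N) ->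
  avoidable t m.+2 (t.*2 * (t.*2 * e + 2)).
Proof.
have [f [zeta [prim_zeta f_inj fN]]] := signed_colours => tm short.
pose V := (option F * 'I_t.*2)%type.
pose g (u v : V) := zeta ^+ u.2 * zeta ^+ v.2 * det u.1 v.1 ^+ e.
pose c (u v : V) := if u.1 == v.1 then ((u.2 < v.2)%N, (f 0).2) else f (g u v).
have zeta0 (i : nat) : zeta ^+ i != 0.
  by rewrite expf_neq0 // (prim_root_eq0 prim_zeta) double_eq0 -lt0n.
have zeta_inj (i j : 'I_t.*2) : zeta ^+ i = zeta ^+ j -> i = j.
  move/eqP; rewrite (eq_prim_root_expr prim_zeta) !modn_small //.
  by move/eqP/val_inj.
have gN u v : g v u = - g u v.
  rewrite /g detN exprNn -signr_odd odd_e mulN1r mulrN.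
  by rewrite [zeta ^+ v.2 * _]mulrC.
have g_unity u v : u.1 != v.1 -> g u v \in [pred z | z ^+ t.*2 == 1].
  move=> uv; rewrite inE !exprMn residue_colour_unity ?det_eq0 //.
  by rewrite (exprAC zeta u.2) (exprAC zeta v.2) (prim_expr_order prim_zeta)
    !expr1n !mulr1.
exists V, c; split.
- by rewrite card_prod card_option cardF card_ord mulnC; lia.
- move=> [p i] [q j]; rewrite /c /= [q == p]eq_sym.
  case: (eqVneq p q) => [->|pq _] /=.
    rewrite xpair_eqE eqxx /= /flip /= => ij.
    by rewrite ltnNge leq_eqVlt negb_or -ltnNge ltn_neqAle ij.
  by rewrite gN fN ?g_unity // eq_sym.
(* A point is determined by its line and its colour to one point outside. *)
have gI u v w : v.1 = w.1 -> u.1 != v.1 -> g u v = g u w -> v = w.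
  case: v w => [p i] [q j] /= <-{q} up; rewrite /g /=.
  move/(mulIf (expf_neq0 e _))/(mulfI (zeta0 _))/zeta_inj-> => //.
  by rewrite det_eq0.
move=> k [//|x s]; set r := (r in pairwise r) => /[dup]/andP[/allP xs ss] ps.
rewrite ltnNge; apply/negP => big.
have irr_r : irreflexive r by move=> v; rewrite /r eqxx.
have us : uniq (x :: s) by apply: pairwise_uniq ps.
have f_of v w : r v w -> v.1 != w.1 -> f (g v w) = k.
  by rewrite /r /c => /andP[_ /eqP<-] /negbTE->.
have /hasP[w ws wx] : has (fun w => x.1 != w.1) s.
  apply: contraLR tm => /hasPn fibre.
  have fibre_s v : v \in x :: s -> v.1 = x.1.
    by rewrite inE => /predU1P[->//|/fibre /negbNE/eqP].
  rewrite -leqNgt (leq_trans big) // -(size_map snd) -[leqRHS]card_ord.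
  have snd_s : uniq (map snd (x :: s)).
    rewrite map_inj_in_uniq // => -[p i] [q j] /fibre_s /= -> /fibre_s /= ->.
    by move=> ->.
  by rewrite -(card_uniqP snd_s) max_card.
have zE : f (g x w) = k by apply: f_of (xs _ ws) wx.
set z := g x w in zE.
have r_g v v' : r v v' -> v.1 != v'.1 -> g v v' = z.
  by move=> rv vv'; apply: f_inj; rewrite ?g_unity // zE f_of.
(* A second point v on the line of x comes after w: if it came before, v and x
   would have the same colour to w. *)
have fibre_x v : v \in s -> v.1 = x.1 -> g w v = z.
  move=> vs vx; have vw : v != w by apply: contra wx => /eqP<-; rewrite vx.
  have vx' : v != x by apply: contraTneq us => <-; rewrite /= vs.
  have := pairwise_total ss vs ws vw.
  case/orP=> /r_g; rewrite vx => gz; last by apply: gz; rewrite eq_sym.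
  case/eqP: vx'; apply: (gI w) => //; first by rewrite vx eq_sym.
  by rewrite gN gz // gN.
have small_fibre : (size [seq v <- s | x.1 == v.1] <= 1)%N.
  have : uniq [seq v <- s | x.1 == v.1] by case/andP: us => _ /filter_uniq.
  have : {subset [seq v <- s | x.1 == v.1]
            <= [pred v | (v \in s) && (x.1 == v.1)]}.
    by move=> v; rewrite mem_filter inE andbC.
  case: {+}(filter _ _) => [|v [|v' s']] //= fib; rewrite inE negb_or -andbA.
  have /andP[vs /eqP vx] := fib v (mem_head _ _).
  have /andP[vs' /eqP vx'] : v' \in [pred v | (v \in s) && (x.1 == v.1)].
    by apply: fib; rewrite !inE eqxx orbT.
  case/andP=> /eqP[]; apply: (gI w); first by rewrite -vx.
    by rewrite -vx eq_sym.
  by rewrite !fibre_x.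
(* The colour z of (x, v) fixes the scalar of v in terms of its line; putting
   this into the colour z of (u, v) leaves zeta^(2 x.2) / z. *)
have := short (zeta ^+ x.2 ^+ 2 / z) [seq chart x.1 v.1 | v <- s & x.1 != v.1].
rewrite size_map ltnNge; suff ->: (m <= size [seq v <- s | x.1 != v.1])%N.
  move=> /= abs; apply/notF/abs; rewrite pairwise_map.
  have allP : all (fun v => (x.1 != v.1) && (g x v == z))
                  [seq v <- s | x.1 != v.1].
    apply/allP => v; rewrite mem_filter => /andP[xv vs].
    by rewrite xv (r_g x v (xs _ vs) xv) eqxx.
  apply: (sub_in_pairwise _ allP) (pairwise_filter _ ss) => u v /andP[xu /eqP xuz].
  move=> /andP[xv /eqP xvz] ruv.
  have uv : u.1 != v.1.
    apply: contraTneq ruv => uv; rewrite (gI _ _ _ uv xu) ?irr_r //; congruence.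
  have z0 : z != 0.
    by rewrite /z /g !mulf_neq0 ?zeta0 ?expf_neq0 ?det_eq0.
  have chartE : z * (chart x.1 v.1 - chart x.1 u.1) ^+ e = zeta ^+ x.2 ^+ 2.
    apply: (mulfI z0); rewrite -{3}(r_g _ _ ruv uv) -{1}xuz -xvz /g.
    by rewrite -(chart_det xu xv) !exprMn; ring.
  rewrite /residue_arc /= -chartE [_ / z]mulrC mulKf // eqxx andbT.
  have : zeta ^+ x.2 ^+ 2 != 0 by rewrite expf_neq0.
  rewrite -chartE; apply: contraNneq => ->.
  by rewrite subrr expr0n; case: e e_gt0 => //= e' _; rewrite mulr0.
have := count_predC (fun v => x.1 == v.1) s.
rewrite -!size_filter => szE; move: big; rewrite /= -szE.
move: small_fibre; rewrite ltnS; case: (size _) => [|[]] // _.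
by rewrite add0n => /ltnW.
Qed.

(** For a chain a, b, ... of colour z, the map x |-> (x - a) / (b - a) divides
    colours by (b - a)^e = z; it sends a and b to 0 and 1. *)
Lemma residue_chain_normalization z m :
  (forall s, pairwise (residue_arc 1) s ->
     all (fun x => (x ^+ e == 1) && ((x - 1) ^+ e == 1)) s -> (size s < m)%N) ->
  forall s, pairwise (residue_arc z) s -> (size s < m.+2)%N.
Proof.
move=> short [|a [|b s]] //= /andP[/andP[/andP[ab /eqP zE] as_]] /andP[bs ps].
have d0 : b - a != 0 by rewrite subr_eq0 eq_sym.
have ze0 : z != 0 by rewrite -zE expf_neq0.
have scale x y : (y - x) ^+ e == z ->
    ((y - a) / (b - a) - (x - a) / (b - a)) ^+ e == 1.
  rewrite -mulrBl opprB addrA subrK exprMn => /eqP->.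
  by rewrite exprVn zE mulfV.
have := short [seq (x - a) / (b - a) | x <- s]; rewrite size_map !ltnS; apply.
  rewrite pairwise_map; apply: sub_pairwise ps => x y /= /andP[xy xyz].
  rewrite /residue_arc /= scale // andbT.
  by apply: contra xy => /eqP/(mulIf _)/addIr->; rewrite ?invr_eq0.
rewrite all_map; apply/allP => x xs /=.
move/allP/(_ x xs)/andP: as_ => [_ ax]; move/allP/(_ x xs)/andP: bs => [_ bx].
move/scale: ax; rewrite subrr mul0r subr0 => -> /=.
by move/scale: bx; rewrite mulfV.
Qed.

End PowerResidues.

(** * Exhaustive search for chains *)

Fixpoint has_chain T (r : rel T) m (l : seq T) : bool :=
  if m is m'.+1 then has (fun x => has_chain r m' (filter (r x) l)) l else true.

Lemma has_chainPn (T : eqType) (r : rel T) m l s : ~~ has_chain r m l ->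
  pairwise r s -> {subset s <= l} -> size s < m.
Proof.
move=> no ps sl; rewrite ltnNge; apply: contra no.
elim: m s l ps sl => //= m IHm [|x s] // l /= /andP[/allP rx ps] sl ms.
apply/hasP; exists x; first by rewrite sl ?mem_head.
apply: IHm ps _ ms => y ys; rewrite mem_filter rx //.
by rewrite sl // inE ys orbT.
Qed.

(** * The search over prime fields, in binary arithmetic *)

Section BinaryResidues.

Import NArith.
Local Open Scope N_scope.

Fixpoint powmod (p a : N) (e : positive) : N :=
  match e with
  | xH => a
  | xO e' => let b := powmod p a e' in (b * b) mod p
  | xI e' => let b := powmod p a e' in (a * ((b * b) mod p)) mod p
  end.

(* The outer reduction matters when e = 1, where powmod leaves a unreduced. *)
Definition residue_code (p : N) (e : positive) (a : N) :=
  powmod p a e mod p =? 1.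

(* Subtraction in N is truncated, hence b + (p - a) for a <= p. *)
Definition residue_arc_code p e : rel N :=
  fun a b => residue_code p e (b + (p - a)).

Definition residue_check (p e m : nat) :=
  let P := bin_of_nat p in let e' := Pos.of_nat e in
  ~~ has_chain (residue_arc_code P e') m
    [seq a <- map bin_of_nat (iota 0 p) |
      residue_code P e' a && residue_arc_code P e' 1 a].

End BinaryResidues.

Lemma nat_of_bin_lt a b : BinNat.N.lt a b -> (a < b)%N.
Proof.
move=> ab; rewrite -(BinNat.N.sub_add a b (BinNat.N.lt_le_incl a b ab)).
case: (BinNat.N.sub b a) (BinNat.N.sub_gt b a ab) => // d _.
case: a {ab} => [|a] /=; rewrite ?nat_of_add_pos; last by lia.
by elim: d => //= d; rewrite natTrecE double_gt0.
Qed.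

Section PrimeField.

Variables (p e : nat).
Hypotheses (p_pr : prime p) (e_gt0 : 0 < e).

Local Open Scope ring_scope.

Local Notation P := (bin_of_nat p).
Let q (a : BinNums.N) : 'F_p := (nat_of_bin a)%:R.
Let code (x : 'F_p) : BinNums.N := bin_of_nat x.

Let codeK : cancel code q.
Proof. by move=> x; rewrite /q bin_of_natK natr_Zp. Qed.

Let qD a b : q (BinNat.N.add a b) = q a + q b.
Proof.
by case: a b => [|a] [|b]; rewrite /q /= ?addr0 ?add0r ?nat_of_add_pos ?natrD.
Qed.

Let qM a b : q (BinNat.N.mul a b) = q a * q b.
Proof.
by case: a b => [|a] [|b]; rewrite /q /= ?mulr0 ?mul0r ?nat_of_mul_pos ?natrM.
Qed.

Let P_neq0 : P <> BinNums.N0.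
Proof. by move=> P0; have := prime_gt0 p_pr; rewrite -[p]bin_of_natK P0. Qed.

Let q_P : q P = 0.
Proof. by rewrite /q bin_of_natK pchar_Fp_0. Qed.

Let q_mod a : q (BinNat.N.modulo a P) = q a.
Proof.
by rewrite [in RHS](BinNat.N.div_mod a P P_neq0) qD qM q_P mul0r add0r.
Qed.

Let q_powmod a k : q (powmod P a k) = q a ^+ BinPos.Pos.to_nat k.
Proof.
elim: k => [k IHk|k IHk|] /=; last by rewrite expr1.
  rewrite q_mod !(qM, q_mod) IHk Pnat.Pos2Nat.inj_xI exprS.
  by congr (_ * _); rewrite -expr2 -exprM; congr (_ ^+ _); lia.
rewrite q_mod qM IHk Pnat.Pos2Nat.inj_xO -expr2 -exprM.
by congr (_ ^+ _); lia.
Qed.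

Let residue_codeP a : q a ^+ e = 1 -> residue_code P (BinPos.Pos.of_nat e) a.
Proof.
move=> qa; have : q (BinNat.N.modulo (powmod P a (BinPos.Pos.of_nat e)) P) = 1.
  rewrite q_mod q_powmod Pnat.Nat2Pos.id //; lia.
rewrite /residue_code; set b := BinNat.N.modulo _ _.
have bp : (b < p)%N.
  by rewrite -[p]bin_of_natK; apply/nat_of_bin_lt/BinNat.N.mod_lt.
move/(congr1 (@nat_of_ord _)); rewrite /q val_Fp_nat // modn_small //= => b1.
by rewrite -[b]nat_of_binK b1.
Qed.

Let code_le x : BinNat.N.le (code x) P.
Proof.
apply/BinNat.N.nlt_ge => /nat_of_bin_lt; rewrite !bin_of_natK.
by apply/negP; rewrite -leqNgt -[leqRHS](Fp_cast p_pr) ltnW.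
Qed.

Let residue_arcP x y : residue_arc e 1 x y ->
  residue_arc_code P (BinPos.Pos.of_nat e) (code x) (code y).
Proof.
case/andP=> _ /eqP yx; apply: residue_codeP; rewrite qD codeK -yx.
congr ((_ + _) ^+ _); apply/eqP.
by rewrite -addr_eq0 -{2}[x]codeK -qD BinNat.N.sub_add ?q_P.
Qed.

(** The search only has to find every chain, so it is enough that an arc of
    the field is an arc between the codes of its ends. *)
Lemma prime_field_residue_chains m : residue_check p e m ->
  forall z (s : seq 'F_p), pairwise (residue_arc e z) s -> (size s < m.+2)%N.
Proof.
move=> check z; apply: residue_chain_normalization => s ps /allP res.
rewrite -(size_map code); apply: (has_chainPn check).
  by rewrite pairwise_map; apply: sub_pairwise ps => x y /residue_arcP.
move=> _ /mapP[x /res/andP[/eqP x1 /eqP x2] ->].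
rewrite mem_filter; apply/andP; split; last first.
  by apply: map_f; rewrite mem_iota add0n -[ltnRHS](Fp_cast p_pr) ltn_ord.
apply/andP; split; apply: residue_codeP; rewrite ?codeK //.
rewrite qD codeK -x2; congr ((_ + _) ^+ _).
apply/eqP; rewrite -addr_eq0.
rewrite -[X in _ + X](_ : q (BinNums.Npos BinNums.xH) = 1) //.
rewrite -qD BinNat.N.sub_add ?q_P //.
exact: (@code_le 1).
Qed.

End PrimeField.

(** * The field of order 27 *)

Section FieldOfOrder27.

Local Open Scope ring_scope.

(** The triple (a, b, c) stands for a + b X + c X^2 modulo X^3 - X + 1, which is
    irreducible over F_3.  This concrete model makes the search below a
    computation on closed terms; the field axioms beyond ring identities are
    themselves checked on the 27 elements. *)
Definition F27 : Type := ('F_3 * 'F_3 * 'F_3)%type.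

HB.instance Definition _ := GRing.Zmodule.copy F27 ('F_3 * 'F_3 * 'F_3)%type.
HB.instance Definition _ := Finite.copy F27 ('F_3 * 'F_3 * 'F_3)%type.

(* X^3 = X - 1 and X^4 = X^2 - X. *)
Definition mul27 (x y : F27) : F27 :=
  let: (a, b, c) := x in let: (a', b', c') := y in
  (a * a' - (b * c' + c * b'),
   a * b' + b * a' + (b * c' + c * b') - c * c',
   a * c' + b * b' + c * a' + c * c').

Definition one27 : F27 := (1, 0, 0).

Lemma add27E (a b c a' b' c' : 'F_3) :
  ((a, b, c) : F27) + ((a', b', c') : F27) = (a + a', b + b', c + c').
Proof. by []. Qed.

Lemma mul27C : commutative mul27.
Proof. by move=> [[a b] c] [[a' b'] c']; congr (_, _, _); ring. Qed.

Lemma mul27A : associative mul27.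
Proof.
by move=> [[a b] c] [[a1 b1] c1] [[a2 b2] c2]; congr (_, _, _); ring.
Qed.

Lemma mul1_27 : left_id one27 mul27.
Proof. by move=> [[a b] c]; congr (_, _, _); ring. Qed.

Lemma mul27D : left_distributive mul27 +%R.
Proof.
move=> [[a b] c] [[a1 b1] c1] [[a2 b2] c2].
by rewrite !add27E; congr (_, _, _); ring.
Qed.

Lemma one27_neq0 : one27 != 0.
Proof. by []. Qed.

HB.instance Definition _ :=
  GRing.Zmodule_isComNzRing.Build F27 mul27A mul27C mul1_27 mul27D one27_neq0.

Definition all27 : seq F27 :=
  [seq (ab, c) | ab <- [seq (a, b) | a <- [:: 0; 1; -1], b <- [:: 0; 1; -1]],
                 c <- [:: 0; 1; -1]].

Lemma mem_all27 x : x \in all27.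
Proof.
have mem3 (a : 'F_3) : a \in [:: 0; 1; -1] by case: a => [[|[|[|]]]].
by case: x => [[a b] c]; rewrite !allpairs_f.
Qed.

Definition inv27 (x : F27) := x ^+ 25.

Lemma mulV27 x : x != 0 -> inv27 x * x = 1.
Proof.
move=> x0; apply/eqP; move: x0; apply/implyP; move: x (mem_all27 x); apply/allP.
by vm_compute.
Qed.

Lemma inv27_0 : inv27 0 = 0.
Proof. by rewrite /inv27 expr0n. Qed.

HB.instance Definition _ := GRing.ComNzRing_isField.Build F27 mulV27 inv27_0.

Lemma card_F27 : #|{: F27}| = 27%N.
Proof. by rewrite !card_prod card_Fp. Qed.

Lemma F27_residue_chains z (s : seq F27) :
  pairwise (residue_arc 13 z) s -> (size s < 6)%N.
Proof.
apply: residue_chain_normalization => {}s ps /allP res.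
have check : ~~ has_chain (residue_arc 13 (1 : F27)) 4
    [seq x <- all27 | (x ^+ 13 == 1) && ((x - 1) ^+ 13 == 1)] by vm_compute.
by apply: (has_chainPn check) ps _ => x /res; rewrite mem_filter mem_all27 andbT.
Qed.

End FieldOfOrder27.

(** * The bounds *)

Lemma F829_residue_chains z (s : seq 'F_829) :
  pairwise (residue_arc 207 z) s -> size s < 6.
Proof.
have p_pr : prime 829 by [].
have check : residue_check 829 207 4 by vm_compute.
exact (@prime_field_residue_chains 829 207 p_pr isT 4 check z s).
Qed.

Lemma avoidable_1_3 : avoidable 1 3 3.
Proof.
apply: (@avoidable_residues 'F_3 1 1) => //; first by rewrite card_Fp.
by apply: prime_field_residue_chains => //; vm_compute.
Qed.

Lemma avoidable_2_3 : avoidable 2 3 13.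
Proof.
apply: (@avoidable_residues 'F_13 2 3) => //; first by rewrite card_Fp.
by apply: prime_field_residue_chains => //; vm_compute.
Qed.

Lemma avoidable_1_6 : avoidable 1 6 27.
Proof.
apply: (@avoidable_residues F27 1 13 card_F27) => //.
exact: F27_residue_chains.
Qed.

Lemma avoidable_1_8 : avoidable 1 8 56.
Proof.
apply: (@avoidable_double_cover F27 1 13 card_F27) => //.
exact: F27_residue_chains.
Qed.

Lemma avoidable_2_6 : avoidable 2 6 829.
Proof.
apply: (@avoidable_residues 'F_829 2 207) F829_residue_chains => //.
by rewrite card_Fp.
Qed.

Lemma avoidable_2_8 : avoidable 2 8 3320.
Proof.
apply: (@avoidable_double_cover 'F_829 2 207) F829_residue_chains => //.
by rewrite card_Fp.
Qed.

Theorem theorem1p2 :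
  (forall t : nat, 4 <= t -> 169 * 3 ^ (t - 4) + 1 <= ramsey t 3) /\
  (forall t : nat, 2 <= t ->
     829 * 27 ^ (t - 2) + 1 <= ramsey t 6 /\
     3320 * 56 ^ (t - 2) + 1 <= ramsey t 8).
Proof.
split=> [t t4|t t2].
  have avoidable_4_3 := avoidable_mul avoidable_2_3 avoidable_2_3.
  have := avoidable_iter (t - 4) avoidable_1_3 avoidable_4_3.
  by rewrite subnK //; apply: ramsey_gt.
split; apply: ramsey_gt; rewrite -[in avoidable t](subnK t2).
  exact: avoidable_iter avoidable_1_6 avoidable_2_6.
exact: avoidable_iter avoidable_1_8 avoidable_2_8.
Qed.
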